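(* Let $G$ be a finite group of even order that is R*-sequenceable, and let $H$ be a finite group of odd order. Then the direct product $G\times H$ is R*-sequenceable.
   Context: Let $G$ be a finite group of order $\ell$ with identity $1_G$. $G$ is R-sequenceable if the non-identity elements of $G$ can be ordered as $g_0,g_1,\ldots,g_{\ell-2}$ so that the quotients $g_0^{-1}g_1, g_1^{-1}g_2,\ldots, g_{\ell-3}^{-1}g_{\ell-2}, g_{\ell-2}^{-1}g_0$ are also all the non-identity elements of $G$, each exactly once. $G$ is R*-sequenceable if it admits such an ordering that additionally satisfies $g_0g_2=g_2g_0=g_1$. *)

(* Defs.v *)
From mathcomp Require Import all_boot all_fingroup.
Set Implicit Arguments. Unset Strict Implicit. Unset Printing Implicit Defensive.
Local Open Scope group_scope.

Definition quotients (gT : finGroupType) (s : seq gT) : seq gT :=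
  [seq (nth 1 s i)^-1 * nth 1 s (i.+1 %% size s) | i <- iota 0 (size s)].

Definition nonid (gT : finGroupType) : seq gT := enum [set x : gT | x != 1].

Definition R_sequencing (gT : finGroupType) (s : seq gT) : Prop :=
  perm_eq s (nonid gT) /\ perm_eq (quotients s) (nonid gT).

Definition R_sequenceable (gT : finGroupType) : Prop :=
  exists s : seq gT, R_sequencing s.

Definition Rstar_sequenceable (gT : finGroupType) : Prop :=
  exists s : seq gT, R_sequencing s /\ 2 < size s /\
    nth 1 s 0 * nth 1 s 2 = nth 1 s 1 /\ nth 1 s 2 * nth 1 s 0 = nth 1 s 1.

(* Main.v *)
Require Import Defs.
From mathcomp Require Import all_boot all_fingroup all_solvable.
Set Implicit Arguments. Unset Strict Implicit. Unset Printing Implicit Defensive.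
Local Open Scope group_scope.

(** An R-sequencing of [G] is a permutation [f] of [G] that fixes [1], moves the other
elements in one cycle, and for which [x^-1 * f x] is injective.

Every group [H] of odd order has a permutation [s] consisting of a single cycle for which
[x * s x] is injective. This needs no solvability: take a maximal subgroup [K], some [d]
outside [K], and let [s x = g x g d] for [x] outside [K], where [g] in [K] depends only on
the coset [K x]. Then [x * s x = (x g)^2 d], which is injective as soon as [K x |-> K x g]
permutes the right cosets, because squaring is bijective. Every permutation of the cosets
that preserves the [K]-orbits is of this kind, and since [K] and [d] generate [H], some
such permutation followed by [d] is a single cycle on the cosets. On [K] itself [s] is
free, and the inductive solution for [K] makes the first return to [K] a single cycle.

In [G * H] start from [(g, h) |-> (f g, h^-1)], with the last link of each round
replaced by [h |-> s h^-1], so that consecutive rounds follow [s]. The elements [(1, h)]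
are absorbed as follows. Let [a], [b], [c] begin the R*-sequencing and let [P] select one
element of each pair [{h, h^-1}]. Because [a c = b = c a], the paths [a, b, c] and
[a, 1, c] use the same quotients [c] and [a^-1] in opposite orders; so where [P h] holds
one may send [a] to [1], [1] to [c] and [b] to [b]. This inserts the pairs
[(1, h), (1, h^-1)] in half of the rounds and doubles [b] in the other half. *)

(** * Harmonious permutations of groups of odd order *)

(** Take [w] with the fewest cycles of [w * d]. If the cycle of [x0] were not closed under [e], a
    transposition of equivalent points inside and outside it would merge two cycles. Once closed
    under [e] it is closed under [d] too, and the last hypothesis identifies it with [D]. *)
Lemma merge_cycles (T : finType) (D : {set T}) (e : rel T) (d : {perm T}) x0 :
  equivalence_rel e -> x0 \in D ->
  {in D, forall x, d x \in D} -> {in D, forall x y, e x y -> y \in D} ->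
  (forall A : {set T}, x0 \in A -> A \subset D -> {in A, forall x, d x \in A} ->
     {in A, forall x y, e x y -> y \in A} -> A = D) ->
  exists2 w : {perm T}, forall x, e x (w x) & porbit (w * d) x0 = D.
Proof.
move=> eqe x0D dD eD conn.
have e_refl x : e x x by case: (eqe x x x).
have e_sym x y : e x y = e y x.
  apply/idP/idP => exy; first by rewrite -((eqe x y x).2 exy) e_refl.
  by rewrite -((eqe y x y).2 exy) e_refl.
have e_trans x y z : e x y -> e y z -> e x z by move=> exy; rewrite ((eqe x y z).2 exy).
pose okp (w : {perm T}) := [forall x, e x (w x)].
have ok1 : okp 1 by apply/forallP => x; rewrite perm1.
case: (arg_minnP (fun w : {perm T} => #|porbits (w * d)|) ok1) => w /forallP okw minw.
exists w => //; set s := w * d; set A := porbit s x0.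
have sD : {in D, forall x, s x \in D}.
  by move=> x xD; rewrite permM; apply/dD/(eD _ xD _ (okw x)).
have AD : A \subset D.
  apply/subsetP => _ /porbitP[i ->].
  by elim: i => [|i IH]; rewrite ?expg0 ?perm1 // expgSr permM sD.
have sA : {in A, forall x, s x \in A}.
  by move=> x; rewrite /A -!eq_porbit_mem; have := porbit_perm s 1 x; rewrite expg1 => ->.
have [/forall_inP eA|] := boolP [forall (x | x \in A), [forall y, e x y ==> (y \in A)]].
  have {}eA : {in A, forall x y, e x y -> y \in A}.
    by move=> x xA y exy; have /forallP/(_ y)/implyP := eA x xA; apply.
  apply: conn => //; first exact: porbit_id.
  (* Here [d x] is the image under [s] of [w^-1 x], a point equivalent to [x]. *)
  move=> x xA; rewrite -[x](permKV w) -permM; apply/sA/(eA x xA).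
  by rewrite e_sym -{2}[x](permKV w).
case/forall_inPn => x xA /forallPn[y]; rewrite negb_imply => /andP[exy yA].
pose t := tperm x y.
have okt : okp (t * w).
  apply/forallP => z; rewrite permM; apply: e_trans (okw _).
  by rewrite /t; case: tpermP => [->|->|_ _] //; rewrite e_sym.
have xy : x != y by apply: contraNneq yA => <-.
have xsy : x \notin porbit s y.
  apply: contra yA; rewrite /A -!eq_porbit_mem => /eqP <-.
  by move: xA; rewrite -eq_porbit_mem => /eqP ->.
have := minw _ okt; have := porbits_mul_tperm s x y.
by rewrite /= xsy xy /s mulgA -/t addn2 addn1 => -[<-]; rewrite ltnn.
Qed.

Lemma odd_sqrg_inj (gT : finGroupType) (H : {group gT}) :
  odd #|H| -> {in H &, injective (fun x => x * x)}.
Proof.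
move=> oddH x y xH yH /= E.
have coH : coprime #|H| 2 by rewrite coprimen2.
by apply: (can_in_inj (expgK coH)) => //; rewrite /= !expgS !expg1.
Qed.

Lemma odd_sqrg_mem (gT : finGroupType) (H K : {group gT}) x :
  odd #|H| -> x \in H -> x * x \in K -> x \in K.
Proof.
move=> oddH xH; have coH : coprime #|H| 2 by rewrite coprimen2.
by move=> xxK; rewrite -(expgK coH xH) /= expgS expg1 groupX.
Qed.

(** Supplies the last hypothesis of [merge_cycles] for cosets: the stabilizer of [A] under right
    translation contains [K] and [d], hence [H] by maximality, and [H] is transitive on the
    cosets. *)
Lemma maximal_rcosets_conn (gT : finGroupType) (K H : {group gT}) d (A : {set {set gT}}) :
  [max K of M | M \proper H] -> d \in H :\: K ->
  (K : {set gT}) \in A -> A \subset rcosets K H ->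
  {in A, forall X, X :* d \in A} -> {in A, forall X k, k \in K -> X :* k \in A} ->
  A = rcosets K H.
Proof.
move=> /maxgroupP[/andP[KH nHK] maxK] /setDP[dH dK] KA AH Ad AK.
have stabK : K \subset 'N(A | 'Rs).
  apply/subsetP => k kK; rewrite !inE /=; apply/subsetP => X XA.
  by rewrite inE /= rcosetE AK.
have stabd : d \in 'N(A | 'Rs).
  by rewrite !inE /=; apply/subsetP => X XA; rewrite inE /= rcosetE Ad.
have sN : (K <*> <[d]>)%G \subset 'N(A | 'Rs).
  by rewrite join_subG stabK cycle_subG.
have eH : H \subset (K <*> <[d]>)%G.
  apply: contraR dK => nHj; rewrite -(maxK (K <*> <[d]>)%G) ?joing_subl //.
    by rewrite mem_gen // inE cycle_id orbT.
  by rewrite properE nHj join_subG KH cycle_subG dH.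
apply/eqP; rewrite eqEsubset AH; apply/subsetP => _ /rcosetsP[x xH ->].
have xN := subsetP sN x (subsetP eH x xH).
by have := astabs_act (K : {set gT}) xN; rewrite /= rcosetE => ->.
Qed.

Lemma odd_harmonious (gT : finGroupType) (H : {group gT}) : odd #|H| ->
  exists2 s : {perm gT}, porbit s 1 = H & {in H &, injective (fun x => x * s x)}.
Proof.
have [m] := ubnP #|H|; elim: m H => // m IH H /ltnSE leHm oddH.
have [/eqP H1|ntH] := boolP (H :==: 1).
  exists 1; last by move=> x y; rewrite H1 => /set1P-> /set1P->.
  apply/setP => x; rewrite H1 inE; apply/porbitP/eqP => [[i ->]|->].
    by rewrite expg1n perm1.
  by exists 0; rewrite perm1.
have [|K maxK _] := @maxgroup_exists _ (fun M : {group gT} => M \proper H) 1%G.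
  by rewrite proper1G.
have pKH : K \proper H by case/maxgroupP: maxK.
have KH := proper_sub pKH.
have oddK : odd #|K| by apply: dvdn_odd (cardSg KH) oddH.
have [k0 k0K k0inj] := IH K (leq_trans (proper_card pKH) leHm) oddK.
have [d dHK] : exists d, d \in H :\: K.
  by have [_ [d dH dK]] := properP pKH; exists d; rewrite inE dK.
have [dH dK] := setDP dHK.
pose e (X Y : {set gT}) := Y \in orbit 'Rs K X.
pose dd : {perm {set gT}} := actperm 'Rs d.
have ddE X : dd X = X :* d by rewrite actpermE /= rcosetE.
have eP X Y : reflect (exists2 k, k \in K & X :* k = Y) (e X Y).
  by apply: (iffP orbitP) => -[k kK <-]; exists k; rewrite /= ?rcosetE.
have rH : {in H, forall x, K :* x \in rcosets K H}.
  by move=> x xH; rewrite -rcosetE imset_f.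
have rHM X x : x \in H -> X \in rcosets K H -> X :* x \in rcosets K H.
  by move=> xH /rcosetsP[y yH ->]; rewrite -rcosetM rH ?groupM.
have [|||||w ew wd] := @merge_cycles _ (rcosets K H) e dd K.
- move=> X Y Z; split; first exact: orbit_refl.
  by rewrite /e => /orbit_eqP ->.
- by rewrite -[X in X \in _]mulg1 rH.
- by move=> X XH; rewrite ddE rHM.
- by move=> X XH Y /eP[k kK <-]; rewrite rHM // (subsetP KH).
- move=> A KA AH Ad Ae; apply: maximal_rcosets_conn maxK dHK _ _ _ _ => //.
    by move=> X XA; rewrite -ddE Ad.
  by move=> X XA k kK; apply: Ae XA _ _; apply/eP; exists k.
(* By [ew] the pick always succeeds, so the default [1] never arises from a failed search. *)
pose g X := odflt 1 [pick k in K | X :* k == w X].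
have gP X : g X \in K /\ X :* g X = w X.
  rewrite /g; case: pickP => [k /andP[kK /eqP] //|noK].
  by have /eP[k kK Ek] := ew X; have := noK k; rewrite kK Ek eqxx.
have gK X : g X \in K by case: (gP X).
have gH X : g X \in H by rewrite (subsetP KH).
(* This is the permutation of the cosets that [s] below induces. *)
pose om := w * dd.
have omE X : om X = X :* (g X * d).
  by rewrite permM ddE -(gP X).2 rcosetM.
have omK : om K = K :* d by rewrite omE rcosetM rcoset_id.
(* The walk of [x] in [K] stays of the form [(st j).1 * _ * (st j).2] until it returns to [K]. *)
pose next_state (p : gT * gT) := let k := g (K :* p.2) in (k * p.1, p.2 * (k * d)).
pose st j := iter j next_state (1, d).
have stS j : st j.+1 = next_state (st j) by [].
have st2 j : K :* (st j).2 = (om ^+ j.+1) K.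
  elim: j => [|j IHj]; first by rewrite expg1 omK.
  by rewrite expgSr permM -IHj omE /= rcosetM.
have st1K j : (st j).1 \in K.
  by elim: j => [|j IHj] //=; rewrite groupM.
have inK x : (x \in K) = (K :* x == K).
  apply/idP/eqP => [/rcoset_id //|<-]; exact: rcoset_refl.
(* The cycle of [om] through [K] closes up after its length; [st j] matches the power [j.+1], hence
   the predecessor. *)
have exn : exists n, (st n).2 \in K.
  exists #|porbit om K|.-1.
  by rewrite inK st2 prednK ?permX ?iter_porbit // lt0n card_porbit_neq0.
case: (ex_minnP exn) => n Dn minn; set gm := (st n).1; set dl := (st n).2.
have gmK : gm \in K := st1K n.
have k0S y : y \in K -> k0 y \in K.
  rewrite -k0K -!eq_porbit_mem => /eqP <-.
  by have := porbit_perm k0 1 y; rewrite expg1 => ->.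
(* Chosen so that the first return [gm * kp x * dl] to [K] is conjugate to [k0]. *)
pose kp x := k0 (gm^-1 * x) * dl^-1.
have kpK x : x \in K -> kp x \in K.
  by move=> xK; rewrite groupM ?groupV // k0S // groupM ?groupV.
(* The identity outside [H] extends the map to a permutation of the whole type. *)
pose s x := if x \in K then kp x * d else
            if x \in H then g (K :* x) * x * (g (K :* x) * d) else x.
have sK x : x \in K -> s x = kp x * d by rewrite /s => ->.
have sH x : x \in H -> x \notin K -> s x = g (K :* x) * x * (g (K :* x) * d).
  by rewrite /s => -> /negPf ->.
have sHH x : x \in H -> s x \in H.
  move=> xH; have [xK|xK] := boolP (x \in K).
    by rewrite sK // groupM // (subsetP KH) // kpK.
  by rewrite sH // !groupM.
have omS x : x \in H -> om (K :* x) = K :* s x.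
  move=> xH; have [xK|xK] := boolP (x \in K).
    by rewrite (rcoset_id xK) omK sK // rcosetM (rcoset_id (kpK _ xK)).
  by rewrite omE sH // -(mulgA (g _) x) -rcosetM [RHS]rcosetM (rcoset_id (gK _)).
have s_inj : injective s.
  move=> x y Es; have [xH|xH] := boolP (x \in H); have [yH|yH] := boolP (y \in H).
  - have Kxy : K :* x = K :* y by apply: (@perm_inj _ om); rewrite !omS // Es.
    have xyK : (x \in K) = (y \in K) by rewrite !inK Kxy.
    have [xK|xK] := boolP (x \in K).
      by move: Es; rewrite !sK -?xyK // => /mulIg/mulIg/perm_inj/mulgI.
    by move: Es; rewrite !sH -?xyK // Kxy => /mulIg/mulgI.
  - have := sHH x xH; rewrite Es /s (negPf yH) ifN ?(negPf yH) //.
    by apply: contra yH; apply: (subsetP KH).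
  - have := sHH y yH; rewrite -Es /s (negPf xH) ifN ?(negPf xH) //.
    by apply: contra xH; apply: (subsetP KH).
  - have outK z : z \notin H -> z \notin K by apply: contra; apply: (subsetP KH).
    by move: Es; rewrite /s (negPf xH) (negPf yH) !ifN ?outK.
pose p := perm s_inj.
have iter_om x i : x \in H -> iter i s x \in H /\ (om ^+ i) (K :* x) = K :* iter i s x.
  move=> xH; elim: i => [|i [IHH IHi]] /=; first by rewrite expg0 perm1.
  by split; [apply: sHH | rewrite expgSr permM IHi omS].
have iterE i x : (p ^+ i) x = iter i s x.
  by rewrite permX; apply: eq_iter => y; rewrite permE.
have return_state x j : x \in K -> j <= n ->
    iter j s (s x) = (st j).1 * kp x * (st j).2.
  move=> xK; elim: j => [|j IHj] lejn; first by rewrite /= mul1g sK.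
  rewrite iterS IHj ?(ltnW lejn) //.
  have coset_j : K :* ((st j).1 * kp x * (st j).2) = K :* (st j).2.
    by rewrite rcosetM (rcoset_id (groupM (st1K j) (kpK x xK))).
  have inH : (st j).1 * kp x * (st j).2 \in H.
    by rewrite -IHj ?(ltnW lejn) // -iterSr (iter_om x j.+1 (subsetP KH x xK)).1.
  have outK : (st j).1 * kp x * (st j).2 \notin K.
    by rewrite inK coset_j -inK; apply: contraL lejn => /minn; rewrite leqNgt.
  by rewrite sH // coset_j stS /next_state /= !mulgA.
have returnE y : y \in K -> (p ^+ n.+1) (gm * y) = gm * k0 y.
  move=> yK; rewrite iterE iterSr return_state ?groupM // /kp mulKg -/gm -/dl.
  by rewrite mulgA mulgKV.
have K_orbit : {subset K <= porbit p gm}.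
  move=> x xK; rewrite -[x](mulKVg gm).
  have : gm^-1 * x \in porbit k0 1 by rewrite k0K groupM ?groupV.
  case/porbitP => i ->; elim: i => [|i IHi]; first by rewrite perm1 mulg1 porbit_id.
  rewrite expgSr permM -returnE; last by rewrite -k0K mem_porbit.
  by rewrite -eq_porbit_mem porbit_perm eq_porbit_mem.
have one_gm : porbit p 1 = porbit p gm.
  by apply/eqP; rewrite eq_porbit_mem K_orbit.
exists p.
  apply/setP => x; apply/idP/idP => [/porbitP[i ->]|xH].
    by rewrite iterE (iter_om 1 i _).1.
  (* Since [om] is a single cycle on the cosets, every [x] in [H] is carried into [K] by a power of
     [p], and [K] lies in one cycle. *)
  have /porbitP[i Ki] : (K : {set gT}) \in porbit om (K :* x).
    by rewrite porbit_sym wd rH.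
  rewrite -[_ \in _]/(x \in porbit p 1) one_gm.
  suff : (p ^+ i) x \in porbit p gm by rewrite -!eq_porbit_mem porbit_perm.
  by apply: K_orbit; rewrite iterE inK -(iter_om x i xH).2 -Ki.
have sqE x : x \in H -> x \notin K ->
    x * p x = (x * g (K :* x)) * (x * g (K :* x)) * d.
  by move=> xH xK; rewrite permE sH // !mulgA.
have pK x : x \in K -> x * p x = x * kp x * d by move=> xK; rewrite permE sK // mulgA.
(* Values of [x * p x] coming from [K] lie in [K :* d]. The others do not, as in odd order a square
   lies in [K] only if its root does. *)
have outK x : x \in H -> x \notin K -> (x * g (K :* x)) * (x * g (K :* x)) \notin K.
  move=> xH xK; apply: contra xK => /(odd_sqrg_mem oddH) xgK.
  by rewrite -(groupMr x (gK (K :* x))) xgK ?groupM.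
move=> x y xH yH /=; have [xK|xK] := boolP (x \in K); have [yK|yK] := boolP (y \in K).
(* With [z = gm^-1 * x], the product [x * kp x] is [gm * (z * k0 z) * dl^-1], so [k0inj] applies. *)
- rewrite (pK x xK) (pK y yK) => /mulIg; rewrite /kp !mulgA => /mulIg E.
  apply: (mulgI gm^-1); apply: k0inj; rewrite ?groupM ?groupV //=.
  by rewrite -!mulgA E.
- rewrite (pK x xK) (sqE y yH yK) => /mulIg E; have := outK y yH yK.
  by rewrite -E groupM ?kpK.
- rewrite (pK y yK) (sqE x xH xK) => /mulIg E; have := outK x xH xK.
  by rewrite E groupM ?kpK.
rewrite (sqE x xH xK) (sqE y yH yK) => /mulIg/(odd_sqrg_inj oddH) E.
have {}E : x * g (K :* x) = y * g (K :* y) by apply: E; rewrite groupM.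
(* The coset of [x * g (K :* x)] is the image of [K :* x] under the permutation [w]. *)
have Kxy : K :* x = K :* y.
  by apply: (@perm_inj _ w); rewrite -!(gP _).2 -!rcosetM E.
by move: E; rewrite Kxy => /mulIg.
Qed.

(** * R-sequencings as cyclic orthomorphisms *)

Definition cyclic_orthomorphism (gT : finGroupType) (f : gT -> gT) (x0 : gT) :=
  [/\ f 1 = 1, injective f, injective (fun x => x^-1 * f x), x0 != 1
    & forall x, x != 1 -> fconnect f x0 x].

Lemma mem_nonid (gT : finGroupType) (x : gT) : (x \in nonid gT) = (x != 1).
Proof. by rewrite mem_enum inE. Qed.

Lemma size_nonid (gT : finGroupType) : size (nonid gT) = #|gT|.-1.
Proof.
rewrite -cardE (cardD1 (1 : gT) gT) inE /=.
by apply: eq_card => x; rewrite !inE andbT.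
Qed.

Lemma quotientsE (gT : finGroupType) (s : seq gT) :
  uniq s -> quotients s = [seq x^-1 * next s x | x <- s].
Proof.
move=> us; apply: (@eq_from_nth _ 1); rewrite ?size_map ?size_iota // => i lti.
rewrite (nth_map 0) ?size_iota // nth_iota // add0n (nth_map 1) // next_nth mem_nth //.
case: s us lti => // y s us lti; rewrite index_uniq //=; congr (_ * _).
move: lti; rewrite ltnS leq_eqVlt => /predU1P[->|lti].
  by rewrite modnn /= nth_default.
by rewrite modn_small //=; apply: set_nth_default.
Qed.

Lemma R_sequencing_next (gT : finGroupType) (s : seq gT) :
  R_sequencing s -> s != [::] -> cyclic_orthomorphism (next s) (nth 1 s 0).
Proof.
case=> ps pq ns.
have us : uniq s by rewrite (perm_uniq ps) enum_uniq.
have ms x : (x \in s) = (x != 1) by rewrite (perm_mem ps) mem_nonid.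
(* [next] fixes whatever is not in the sequence. *)
have next1 : next s 1 = 1 by rewrite next_nth ms eqxx.
rewrite quotientsE // in pq.
have /dinjectiveP q_inj : dinjectiveb (fun x => x^-1 * next s x) [set x : gT | x != 1].
  by rewrite /dinjectiveb -(perm_uniq (perm_map _ ps)) (perm_uniq pq) enum_uniq.
have mq x : x != 1 -> x^-1 * next s x != 1.
  by rewrite -ms -[_ != 1]mem_nonid -(perm_mem pq) => xs; apply: map_f.
have s0 : nth 1 s 0 \in s by rewrite mem_nth // lt0n size_eq0.
split=> //; first exact: can_inj (prev_next us).
- move=> x y /= E; have [x1|nx] := eqVneq x 1; have [y1|ny] := eqVneq y 1.
  + by rewrite x1 y1.
  + by have := mq y ny; rewrite -E x1 next1 mulVg eqxx.
  + by have := mq x nx; rewrite E y1 next1 mulVg eqxx.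
  + by apply: q_inj; rewrite ?inE.
- by rewrite -ms.
by move=> x; rewrite -ms => xs; rewrite (fconnect_cycle (cycle_next us)).
Qed.

Lemma R_sequencing_orbit (gT : finGroupType) (f : gT -> gT) x0 :
  cyclic_orthomorphism f x0 -> R_sequencing (fingraph.orbit f x0).
Proof.
case=> f1 finj qinj x01 conn; set s := fingraph.orbit f x0.
have us : uniq s by apply: orbit_uniq.
have ms x : (x \in s) = (x != 1).
  rewrite -fconnect_orbit; apply/idP/idP => [x0x|/conn //].
  apply: contraNneq x01 => x1; rewrite fconnect_sym // x1 in x0x.
  by rewrite -(iter_findex x0x) iter_fix.
have ps : perm_eq s (nonid gT).
  by apply: uniq_perm; rewrite ?enum_uniq // => x; rewrite ms mem_nonid.
have nextE x : x \in s -> next s x = f x.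
  by move=> xs; apply/esym/eqP; apply: (next_cycle (cycle_orbit finj x0)) xs.
have qE : quotients s = [seq x^-1 * f x | x <- s].
  by rewrite quotientsE //; apply/eq_in_map => x xs; rewrite nextE.
split=> //; rewrite qE.
have uq : uniq [seq x^-1 * f x | x <- s] by rewrite map_inj_uniq.
have sq : {subset [seq x^-1 * f x | x <- s] <= nonid gT}.
  (* The quotient [1] is already attained at [1], so injectivity excludes it elsewhere. *)
  move=> _ /mapP[x xs ->]; rewrite mem_nonid; rewrite ms in xs.
  by apply: contra xs => /eqP E; apply/eqP/qinj; rewrite /= E f1 mulg1 invg1.
have [|] := uniq_min_size uq sq; first by rewrite size_map (perm_size ps).
by move=> _ eqi; apply: uniq_perm; rewrite ?enum_uniq.
Qed.

(** * The orthomorphism of the direct product *)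

(** Of [h] and [h^-1], the one enumerated first is selected; odd order excludes involutions, so the
    two differ for [h != 1]. *)
Lemma half_set (gT : finGroupType) : odd #|gT| ->
  exists2 P : pred gT, ~~ P 1 & forall h, h != 1 -> P h^-1 = ~~ P h.
Proof.
move=> odd_gT; exists (fun h => enum_rank h < enum_rank h^-1); first by rewrite invg1 ltnn.
move=> h h1; rewrite invgK -leqNgt ltn_neqAle.
suff hV : h^-1 != h by rewrite (inj_eq val_inj) (inj_eq enum_rank_inj) hV.
apply: contra h1 => /eqP hV; have odd_set : odd #|[set: gT]| by rewrite cardsT.
by apply/eqP/(odd_sqrg_inj odd_set); rewrite ?inE //= mulg1 -{1}hV mulVg.
Qed.

Section ProductOrthomorphism.

Variables (G H : finGroupType) (f : G -> G) (a : G) (P : pred H) (s : H -> H).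
Hypotheses (fP : cyclic_orthomorphism f a) (G_gt3 : 3 < #|G|).
Hypothesis evenG : ~~ odd #|G|.
Hypotheses (ac : a * f (f a) = f a) (ca : f (f a) * a = f a).
Hypotheses (oddH : odd #|H|) (P1 : ~~ P 1) (PV : forall h, h != 1 -> P h^-1 = ~~ P h).
Hypotheses (s_inj : injective s) (s_conn : forall h, fconnect s 1 h).
Hypothesis s_harm : injective (fun h => h * s h).

Let b := f a.
Let c := f b.

(* [f \o detour h] sends [a] to [1], [1] to [c] and [b] to [b] when [P h] holds. *)
Definition detour (h : H) : {perm G} := if P h then tperm a 1 * tperm a b else 1.

Definition product_map (x : G * H) : G * H :=
  (f (detour x.2 x.1), if f x.1 == a then s x.2^-1 else x.2^-1).

Let f1 : f 1 = 1. Proof. by case: fP. Qed.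
Let f_inj : injective f. Proof. by case: fP. Qed.
Let q_inj : injective (fun x => x^-1 * f x). Proof. by case: fP. Qed.
Let a1 : a != 1. Proof. by case: fP. Qed.
Let f_conn g : g != 1 -> fconnect f a g. Proof. by case: fP => _ _ _ _; apply. Qed.

Let order_a : fingraph.order f a = #|G|.-1.
Proof.
have := R_sequencing_orbit fP; case=> /perm_size.
by rewrite size_orbit size_nonid.
Qed.

Let iter_f_inj i j : i < #|G|.-1 -> j < #|G|.-1 -> iter i f a = iter j f a -> i = j.
Proof. by rewrite -order_a => li lj E; rewrite -(findex_iter li) E findex_iter. Qed.

Let iter_f_neq1 i : iter i f a != 1.
Proof.
apply: contraNneq a1; elim: i => [/eqP //|i IH /= E]; apply: IH.
by apply: f_inj; rewrite E f1.
Qed.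

Let b1 : b != 1. Proof. exact: (iter_f_neq1 1). Qed.

Let iter_f_neq i j : i < #|G|.-1 -> j < #|G|.-1 -> i != j -> iter i f a != iter j f a.
Proof. by move=> li lj; apply: contra => /eqP/(iter_f_inj li lj)/eqP. Qed.

Let ab : a != b. Proof. by apply: (@iter_f_neq 0 1); rewrite // ltn_predRL (ltn_trans _ G_gt3). Qed.
Let c_a : c != a. Proof. by apply: (@iter_f_neq 2 0); rewrite // ltn_predRL // (ltn_trans _ G_gt3). Qed.

Let detour_a h : P h -> detour h a = 1.
Proof. by rewrite /detour => ->; rewrite permM tpermL tpermD. Qed.

Let detour_1 h : P h -> detour h 1 = b.
Proof. by rewrite /detour => ->; rewrite permM tpermR tpermL. Qed.

Let detour_b h : P h -> detour h b = a.
Proof. by rewrite /detour => ->; rewrite permM [tperm a 1 b]tpermD ?tpermR // eq_sym. Qed.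

Let detour_out h g : g != a -> g != 1 -> g != b -> detour h g = g.
Proof.
rewrite /detour; case: (P h) => ga g1 gb; last by rewrite perm1.
by rewrite permM !tpermD // eq_sym.
Qed.

Let detour_id h g : ~~ P h -> detour h g = g.
Proof. by rewrite /detour => /negPf ->; rewrite perm1. Qed.

(** For fixed [h] the detour merely permutes the quotients of [f]: [ca] gives [a^-1 = b^-1 * c] and
    [ac] gives [c = a^-1 * b]. *)
Let quotient_detour h g : g^-1 * f (detour h g) = ((detour h)^-1 g)^-1 * f ((detour h)^-1 g).
Proof.
have [Ph|nPh] := boolP (P h); last first.
  by rewrite /detour (negPf nPh) invg1 !perm1.
have V x y : detour h x = y -> (detour h)^-1 y = x by move<-; rewrite permK.
have [->|ga] := eqVneq g a.
  rewrite detour_a // (V _ _ (detour_b Ph)) f1 mulg1.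
  by apply: (mulIg a); rewrite mulVg -mulgA ca mulVg.
have [->|g1] := eqVneq g 1.
  by rewrite detour_1 // (V _ _ (detour_a Ph)) invg1 mul1g; apply: (mulgI a); rewrite mulKVg.
have [->|gb] := eqVneq g b.
  by rewrite detour_b // (V _ _ (detour_1 Ph)) invg1 mul1g mulVg f1.
by rewrite (V g g) ?detour_out.
Qed.

(* [g] is the last element of the R*-sequencing. *)
Let last_out g : f g = a -> [/\ g != a, g != 1 & g != b].
Proof.
move=> fg; split; apply/eqP => E; move: fg; rewrite E.
- by move/eqP; rewrite eq_sym (negPf ab).
- by move/eqP; rewrite f1 eq_sym (negPf a1).
- by move/eqP; rewrite (negPf c_a).
Qed.

(** The detour moves only [a], [1] and [b], none of which [f] sends to [a], so the test for the last
    link ignores it. *)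
Let detour_last h g : (f (detour h g) == a) = (f g == a).
Proof.
apply/eqP/eqP => E; last by have [? ? ?] := last_out E; rewrite detour_out.
have [? ? ?] := last_out E.
have /perm_inj E2 : detour h (detour h g) = detour h g by rewrite detour_out.
by rewrite -{1}E2.
Qed.

Let detourV_last h g : (f ((detour h)^-1 g) == a) = (f g == a).
Proof. by rewrite -[in RHS](permKV (detour h) g) detour_last. Qed.

Let sqr_inj : injective (fun h : H => h * h).
Proof.
have odd_set : odd #|[set: H]| by rewrite cardsT.
by move=> x y; apply: (odd_sqrg_inj odd_set); rewrite inE.
Qed.

Lemma product_map_inj : injective product_map.
Proof.
case=> g h [g' h'] [/f_inj Eg].
rewrite /= -(detour_last h) -(detour_last h' g') Eg.
have [_ /s_inj/invg_inj|_ /invg_inj] := ifP => Eh; by move: Eg; rewrite Eh => /perm_inj ->.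
Qed.

(** The first coordinate determines which link is used; the second is then [h^-1 * h^-1] or
    [h^-1 * s h^-1], both injective in [h]. *)
Lemma product_quotient_inj : injective (fun x => x^-1 * product_map x).
Proof.
case=> g h [g' h'] /= [].
rewrite !quotient_detour => /q_inj Eg.
rewrite -(detourV_last h g) -(detourV_last h' g') Eg.
have [_ /s_harm/invg_inj|_] := ifP; last first.
  rewrite -!invMg => /invg_inj /sqr_inj Eh.
  by move: Eg; rewrite Eh => /perm_inj ->.
by move=> Eh; move: Eg; rewrite Eh => /perm_inj ->.
Qed.

Let step g h : product_map (g, h) = (f (detour h g), if f g == a then s h^-1 else h^-1).
Proof. by []. Qed.

(** * One cycle through all non-identity pairs *)

Let linked (x y : G * H) := fconnect product_map x y.

Let linked_sym x y : linked x y = linked y x.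
Proof. exact: fconnect_sym product_map_inj _ _. Qed.

Let linked1 x : linked x (product_map x). Proof. exact: fconnect1. Qed.

Let linked_trans x y z : linked x y -> linked y z -> linked x z.
Proof. exact: connect_trans. Qed.

Let b_a : (f a == a) = false. Proof. by rewrite eq_sym (negPf ab). Qed.
Let one_a : (f 1 == a) = false. Proof. by rewrite f1 eq_sym (negPf a1). Qed.
Let c_a' : (f b == a) = false. Proof. exact: negPf. Qed.

Let linked_b_c h : exists k, linked (b, h) (c, k).
Proof.
have [Ph|nPh] := boolP (P h); last first.
  by exists h^-1; have := linked1 (b, h); rewrite step detour_id // c_a'.
have h1 : h != 1 by apply: contraTneq Ph => ->.
exists h; have := linked1 (b, h); rewrite step detour_b // c_a' => /linked_trans; apply.
by have := linked1 (b, h^-1); rewrite step detour_id ?PV ?Ph // c_a' invgK.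
Qed.

Let linked_1_c h : h != 1 -> exists k, linked (1, h) (c, k).
Proof.
move=> h1; have [Ph|nPh] := boolP (P h).
  by exists h^-1; have := linked1 (1, h); rewrite step detour_1 // one_a.
exists h; have := linked1 (1, h); rewrite step detour_id // f1 eq_sym (negPf a1).
move=> /linked_trans; apply; have PhV : P h^-1 by rewrite PV.
by have := linked1 (1, h^-1); rewrite step detour_1 // one_a invgK.
Qed.

(** The walk is [(a, h)], [(1, h^-1)], [(1, h)], [(c, h^-1)] if [P h], and has [b] for [1] if
    [P h^-1]; for [h = 1] it is just [a], [b], [c]. *)
Let linked_a_c h : linked (a, h) (c, h^-1).
Proof.
have [Ph|nPh] := boolP (P h).
  have := linked1 (a, h); rewrite step detour_a // b_a f1 => /linked_trans; apply.
  have h1 : h != 1 by apply: contraTneq Ph => ->.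
  have nPV : ~~ P h^-1 by rewrite PV // Ph.
  have := linked1 (1, h^-1); rewrite step detour_id // one_a f1 invgK => /linked_trans; apply.
  by have := linked1 (1, h); rewrite step detour_1 // one_a.
have := linked1 (a, h); rewrite step detour_id // b_a => /linked_trans; apply.
have [->|h1] := eqVneq h 1.
  by have := linked1 (b, 1); rewrite invg1 step detour_id // c_a' invg1.
have PhV : P h^-1 by rewrite PV.
have := linked1 (b, h^-1); rewrite step detour_b // c_a' invgK => /linked_trans; apply.
by have := linked1 (b, h); rewrite step detour_id // c_a'.
Qed.

Let linked_c_iter h i : i.+3 < #|G| ->
  linked (c, h) (iter i f c, if odd i then h^-1 else h).
Proof.
elim: i => [|i IH] lti; first exact: connect0.
apply: linked_trans (IH (ltnW lti)) _; have := linked1 (iter i f c, if odd i then h^-1 else h).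
have cE j : iter j f c = iter j.+2 f a by rewrite -addn2 iterD.
have out : [/\ iter i f c != a, iter i f c != 1 & iter i f c != b].
  have lti' : i.+2 < #|G|.-1 by rewrite ltn_predRL ltnW.
  have lt2 : 2 < #|G|.-1 := leq_ltn_trans (isT : 2 <= i.+2) lti'.
  rewrite cE; split; [|exact: iter_f_neq1|].
    by apply: (@iter_f_neq i.+2 0) => //; apply: ltn_trans lt2.
  by apply: (@iter_f_neq i.+2 1) => //; apply: ltn_trans lt2.
case: out => ? ? ?; rewrite step detour_out // [if f _ == a then _ else _]ifN.
  by rewrite [odd i.+1]/=; case: (odd i); rewrite ?invgK.
by rewrite -iterS cE; apply: (@iter_f_neq i.+3 0); rewrite // ltn_predRL // (ltn_trans _ lti).
Qed.

Let linked_a_next h : linked (a, h) (a, s h).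
Proof.
apply: linked_trans (linked_a_c h) _.
(* From [c] to the last element there are [m] steps; [m] is even, so [h^-1] is restored and the last
   link yields [s h]. *)
have mE : #|G| - 4 + 4 = #|G| := subnK G_gt3; set m := #|G| - 4 in mE.
have evenm : odd m = false by move: evenG; rewrite -mE oddD addbF => /negPf.
have := @linked_c_iter h^-1 m; rewrite -mE addn4 evenm ltnSn => /(_ isT)/linked_trans; apply.
have E : f (iter m f c) = a.
  rewrite -iterS -[c]/(iter 2 f a) -iterD -[RHS](iter_order f_inj) order_a.
  by rewrite -mE addn4 addn2.
have [? ? ?] := last_out E.
by have := linked1 (iter m f c, h^-1); rewrite step detour_out // E eqxx invgK.
Qed.

Let linked_a h : linked (a, 1) (a, h).
Proof.
have /iter_findex <- := s_conn h; elim: (findex _ _ _) => [|i IH]; first exact: connect0.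
exact: linked_trans IH (linked_a_next _).
Qed.

Let linked_c h : linked (a, 1) (c, h).
Proof. by rewrite -[h]invgK; apply: linked_trans (linked_a _) (linked_a_c _). Qed.

Let linked_all x : x != 1 -> linked (a, 1) x.
Proof.
case: x => g h x1; have [g1|g1] := eqVneq g 1.
  have h1 : h != 1 by apply: contraNneq x1 => ->; rewrite g1.
  have [k hk] := linked_1_c h1; rewrite g1.
  by apply: linked_trans (linked_c k) _; rewrite linked_sym.
have ltg : findex f a g < #|G|.-1 by rewrite -order_a findex_max // f_conn.
rewrite -(iter_findex (f_conn g1)); case: findex ltg => [|[|i]] lti; first exact: linked_a.
  have [k hk] := linked_b_c h.
  by apply: linked_trans (linked_c k) _; rewrite linked_sym.
have lti4 : i.+3 < #|G| by rewrite -ltn_predRL.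
have -> : iter i.+2 f a = iter i f c by rewrite -addn2 iterD.
(* The start is chosen so that [i] inversions end at [h]. *)
apply: linked_trans (linked_c (if odd i then h^-1 else h)) _.
by have := linked_c_iter (if odd i then h^-1 else h) lti4; case: (odd i); rewrite ?invgK.
Qed.

Lemma product_cyclic_orthomorphism : cyclic_orthomorphism product_map (a, 1).
Proof.
split; [|exact: product_map_inj|exact: product_quotient_inj| |exact: linked_all].
  by rewrite step detour_id // one_a f1 invg1.
by apply: contraNneq a1 => -[->].
Qed.

Lemma product_map_start : product_map (a, 1) = (b, 1).
Proof. by rewrite step detour_id // b_a invg1. Qed.

Lemma product_map_start2 : product_map (b, 1) = (c, 1).
Proof. by rewrite step detour_id // c_a' invg1. Qed.

End ProductOrthomorphism.

Theorem theorem1 (G H : finGroupType) :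
  ~~ odd #|G| -> Rstar_sequenceable G -> odd #|H| ->
  Rstar_sequenceable (G * H)%type.
Proof.
move=> evenG [t [Rt [t2 [ac ca]]]] oddH.
have nt : t != [::] by rewrite -size_eq0 -lt0n (ltn_trans _ t2).
have fP := R_sequencing_next Rt nt; have [pt _] := Rt.
have ut : uniq t by rewrite (perm_uniq pt) enum_uniq.
have G3 : 3 < #|G| by move: t2; rewrite (perm_size pt) size_nonid ltn_predRL.
have next_t i : i.+1 < size t -> next t (nth 1 t i) = nth 1 t i.+1.
  move=> lti; rewrite next_nth mem_nth ?(ltnW lti) //.
  case: t ut lti {Rt t2 ac ca nt fP pt} => // y t ut lti.
  by rewrite index_uniq // ?(ltnW lti) //=; apply: set_nth_default.
have n1 : next t (nth 1 t 0) = nth 1 t 1 by apply: next_t; apply: ltn_trans t2.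
have n2 : next t (nth 1 t 1) = nth 1 t 2 by apply: next_t.
rewrite -n2 -n1 in ac ca.
have odd_set : odd #|[set: H]%G| by rewrite cardsT.
have [s s1 s_harm] := odd_harmonious odd_set.
have s_conn h : fconnect s 1 h.
  have /porbitP[i ->] : h \in porbit s 1 by rewrite s1 inE.
  by rewrite permX fconnect_iter.
have {}s_harm : injective (fun h => h * s h) by move=> x y; apply: s_harm; rewrite inE.
have [P P1 PV] := half_set oddH.
have FP := product_cyclic_orthomorphism fP G3 evenG ac ca oddH P1 PV perm_inj s_conn s_harm.
set F := product_map _ _ _ _ in FP; set x0 := (_, 1) in FP.
exists (fingraph.orbit F x0); have RF := R_sequencing_orbit FP.
have sz : 2 < size (fingraph.orbit F x0).
  by case: RF => /perm_size -> _; rewrite size_nonid card_prod ltn_predRL;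
    apply: leq_trans G3 _; rewrite leq_pmulr // odd_gt0.
have nthE i : i < size (fingraph.orbit F x0) -> nth 1 (fingraph.orbit F x0) i = iter i F x0.
  by rewrite size_orbit => lti; rewrite (set_nth_default x0) ?size_orbit ?nth_traject.
(* As [P 1] fails there is no detour at [1]: the cycle starts [(a, 1)], [(b, 1)], [(c, 1)] and
   inherits [ac] and [ca]. *)
have F1 : F x0 = _ := product_map_start s fP G3 P1.
have F2 : F (_, 1) = _ := product_map_start2 s fP G3 P1.
rewrite !nthE ?(ltnW sz) ?(ltnW (ltnW sz)) //= F1 F2 /x0.
split=> //; split=> //.
by split; [exact: (congr2 pair ac (mulg1 1)) | exact: (congr2 pair ca (mulg1 1))].
Qed.
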